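(* Let $N \ge 1$, let $x$ be a positive integer with $\phi^N(x) = x$ (i.e. $x$ lies on a periodic orbit of the accelerated Collatz map $\phi$ of period $N$), let $d \in \{0,1\}^N$ be the parity word of $x, \phi(x), \dots, \phi^{N-1}(x)$, and let $r$ be the number of ones in $d$. Then: (1) If $N = 2r$, the periodic orbit is the trivial one, i.e. $\{x,\phi(x),\dots,\phi^{N-1}(x)\} = \{1,2\}$. (2) The case $N > 2r$ is impossible: there is no periodic orbit with $N > 2r$.
   Context: The accelerated Collatz map on the positive integers is $\phi(x) = x/2$ if $x$ is even and $\phi(x) = (3x+1)/2$ if $x$ is odd; $\phi^k$ is its $k$-th iterate. The parity word of length $N$ of the orbit of $x$ is $d=(d_1,\dots,d_N)$ with $d_i = 1$ if $\phi^{i-1}(x)$ is odd and $d_i = 0$ if $\phi^{i-1}(x)$ is even. The trivial periodic orbit is the 2-cycle $1 \leftrightarrow 2$. *)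

(* Defs.v *)
From mathcomp Require Import all_boot.

Set Implicit Arguments.
Unset Strict Implicit.
Unset Printing Implicit Defensive.

(* Only the values at x > 0 are meaningful (collatz 0 = 0 is an artefact of
   working in nat); positive integers are mapped to positive integers. *)
Definition collatz (x : nat) : nat :=
  if odd x then (3 * x + 1) %/ 2 else x %/ 2.

(* Entry i : 'I_N of the tuple is the digit d_(i+1), with true encoding 1. *)
Definition parity_word (N x : nat) : N.-tuple bool :=
  [tuple odd (iter i collatz x) | i < N].

Definition num_ones (N : nat) (d : N.-tuple bool) : nat := count_mem true d.

(* Main.v *)
(* One step satisfies 2 phi(y) = y for y even and 2 phi(y) = 3 y + 1 <= 4 y for
   y odd, with equality exactly when y = 1. Multiplying along the periodic orbit
   gives 2^N x <= 4^r x, hence N <= 2 r, and if N = 2 r then every odd point of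
   the orbit is 1. *)
Require Import Defs.
From mathcomp Require Import all_boot.
From mathcomp Require Import zify.

Set Implicit Arguments.
Unset Strict Implicit.
Unset Printing Implicit Defensive.

Lemma double_collatz (y : nat) :
  2 * collatz y = if odd y then 3 * y + 1 else y.
Proof. by rewrite /collatz; case: ifP => oy; lia. Qed.

Lemma collatz_gt0 (y : nat) : 0 < y -> 0 < collatz y.
Proof. by have := double_collatz y; case: ifP => _; lia. Qed.

(** The exponent [odd y] treats both parities at once: an even [y] gives equality, an odd one leaves
    the gap [y - 1]. *)
Lemma double_collatz_leqif (y : nat) :
  0 < y -> 2 * collatz y <= 4 ^ odd y * y ?= iff (odd y ==> (y == 1)).
Proof.
rewrite double_collatz => y0; apply/leqifP.
by case: (odd y) => /=; case: eqVneq => //; lia.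
Qed.

(** Induction on [n], peeling off the first step. Carrying the equality case along makes a tight
    product force every single step to be tight. *)
Lemma iter_collatz_leqif (n x : nat) : 0 < x ->
  2 ^ n * iter n collatz x <= 4 ^ count odd (traject collatz x n) * x
    ?= iff all [pred y | odd y ==> (y == 1)] (traject collatz x n).
Proof.
elim: n x => [|n IHn] x x0; first by split; rewrite ?eqxx.
have cx0 := collatz_gt0 x0.
rewrite expnS -mulnA iterSr /= expnD.
have -> : 4 ^ odd x * 4 ^ count odd (traject collatz (collatz x) n) * x
  = 4 ^ count odd (traject collatz (collatz x) n) * (4 ^ odd x * x).
  by rewrite mulnAC mulnC.
have le1 := IHn _ cx0.
have le2 : 2 * (2 ^ n * iter n collatz (collatz x)) <=
    4 ^ count odd (traject collatz (collatz x) n) * (2 * collatz x)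
    ?= iff all [pred y | odd y ==> (y == 1)] (traject collatz (collatz x) n).
  by split; rewrite (mulnCA (4 ^ _)) ?leq_pmul2l ?eqn_pmul2l ?le1.
(* The chain meets the tail of the orbit first and its head second, hence the swap of the
   conjunction. *)
rewrite andbC; apply: leqif_trans le2 _.
have le3 := double_collatz_leqif x0.
by split; rewrite ?leq_pmul2l ?eqn_pmul2l ?expn_gt0 ?le3.
Qed.

Lemma num_ones_parity_word (N x : nat) :
  num_ones (parity_word N x) = count odd (traject collatz x N).
Proof.
have -> : traject collatz x N = [seq iter i collatz x | i : 'I_N <- enum 'I_N].
  rewrite [RHS](map_comp (fun i => iter i collatz x) val) val_enum_ord.
  apply: (@eq_from_nth _ x) => [|i]; rewrite size_traject ?size_map ?size_iota //.
  by move=> iN; rewrite nth_traject // (nth_map 0) ?size_iota // nth_iota.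
by rewrite /num_ones !count_map; apply: eq_count => i /=; rewrite eqb_id.
Qed.

Lemma iter_collatz1 (n : nat) : iter n collatz 1 \in [:: 1; 2].
Proof. by elim: n => //= n; rewrite !inE => /orP[]/eqP->. Qed.

Theorem theorem8p1 (N x : nat) (hN : 1 <= N) (hx : 0 < x)
    (hper : iter N collatz x = x) :
  let d := parity_word N x in
  let r := num_ones d in
  (N = 2 * r -> traject collatz x N =i [:: 1; 2]) /\
  ~ (N > 2 * r).
Proof.
move=> d r; have := iter_collatz_leqif N hx.
rewrite hper -num_ones_parity_word -/d -/r -(expnM 2 2 r) => -[le_pow eq_pow].
split=> [Nr|]; last first.
  by move: le_pow; rewrite leq_pmul2r // leq_exp2l //; lia.
have /allP odd1 : all [pred y | odd y ==> (y == 1)] (traject collatz x N).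
  by rewrite -eq_pow Nr.
(* Since [N = 2 * r] is positive, so is [r]. *)
have /hasP[y /trajectP[j jN ->] oddy] : has odd (traject collatz x N).
  by rewrite has_count -num_ones_parity_word -/d -/r; lia.
have yj1 : iter j collatz x = 1.
  apply/eqP; apply: (implyP (odd1 _ _)) oddy.
  by apply/trajectP; exists j.
(* By periodicity [x] is reached from the orbit point 1 after [N - j] further steps. *)
have : x \in [:: 1; 2].
  by rewrite -hper -(subnK (ltnW jN)) iterD yj1 iter_collatz1.
(* [N] is even and positive, so the trajectory has at least two entries; the first two are already 1
   and 2 in some order. *)
have [m ->] : exists m, N = m.+2 by exists N.-2; lia.
rewrite !inE => x12 z; apply/idP/idP => [/trajectP[i _ ->]|].
  (* A start at 2 is read as [collatz 1]. *)
  by case/orP: x12 => /eqP->; rewrite ?iter_collatz1 // -(iterSr i collatz 1) iter_collatz1.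
by case/orP: x12 => /eqP->; rewrite !inE => /orP[]/eqP->.
Qed.
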